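(* If $f:\{0,1\}^n\to\{0,1\}$ is a total Boolean function, then $\mathrm{RS}_{\mathrm{u}}(f)=\mathrm{RS}(f)$.
   Context: Query notions apply to functions on alphabet $\{0,1,*,\dagger\}$, a query to position $i$ returning $x_i$. A randomized algorithm is a probability distribution over deterministic decision trees; $\mathrm{R}_0(h)$ is the minimum, over randomized algorithms that are always correct on every input in the domain of $h$, of the maximum over inputs of the expected number of queries (and is $0$ if the domain is empty). Sabotage: $P_f\subseteq\{0,1,*\}^n$ is the set of $p$ for which there exist $x,y$ in the domain of $f$ with $f(x)\ne f(y)$ and $x_i=y_i=p_i$ whenever $p_i\ne*$; $P_f^\dagger$ is the same with $\dagger$ in place of $*$; $Q_f=P_f\cup P_f^\dagger$; $f_{\mathrm{sab}}:Q_f\to\{0,1\}$ is $0$ on $P_f$ and $1$ on $P_f^\dagger$; $\mathrm{RS}(f)=\mathrm{R}_0(f_{\mathrm{sab}})$. Let $U\subseteq\{0,1,*,\dagger\}^n$ be the set of strings with exactly one position not in $\{0,1\}$. $f_{\mathrm{usab}}$ is the restriction of $f_{\mathrm{sab}}$ to $Q_f\cap U$, and $\mathrm{RS}_{\mathrm{u}}(f)=\mathrm{R}_0(f_{\mathrm{usab}})$ (defined as $0$ if $Q_f\cap U$ is empty). *)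

(* Defs.v *)
From HB Require Import structures.
From mathcomp Require Import all_boot all_order all_algebra.
From mathcomp Require Import all_classical all_reals all_analysis.

Set Implicit Arguments.
Unset Strict Implicit.
Unset Printing Implicit Defensive.

Import Order.TTheory GRing.Theory Num.Theory.

Local Open Scope classical_set_scope.
Local Open Scope ring_scope.
Local Open Scope ereal_scope.

Inductive letter := Bit of bool | Star | Dagger.

Definition letter_encode (a : letter) : bool + bool :=
  match a with Bit b => inl b | Star => inr false | Dagger => inr true end.

Definition letter_decode (u : bool + bool) : letter :=
  match u with inl b => Bit b | inr false => Star | inr true => Dagger end.

Lemma letter_encodeK : cancel letter_encode letter_decode.
Proof. by case. Qed.

HB.instance Definition _ := Finite.copy letter (can_type letter_encodeK).

(* Partial functions are option-valued: [None] means "outside the domain". *)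
Definition bool_fun (n : nat) := {ffun 'I_n -> bool} -> option bool.
Definition letter_fun (n : nat) := {ffun 'I_n -> letter} -> option bool.

Inductive dtree (n : nat) : Type :=
| Leaf of bool
| Query of 'I_n & (letter -> dtree n).

Fixpoint output n (t : dtree n) (x : {ffun 'I_n -> letter}) : bool :=
  match t with
  | Leaf b => b
  | Query i k => output (k (x i)) x
  end.

Fixpoint queries n (t : dtree n) (x : {ffun 'I_n -> letter}) : nat :=
  match t with
  | Leaf _ => 0
  | Query i k => (queries (k (x i)) x).+1
  end.

HB.instance Definition _ (n : nat) := gen_eqMixin (dtree n).
HB.instance Definition _ (n : nat) := gen_choiceMixin (dtree n).
HB.instance Definition _ (n : nat) := isPointed.Build (dtree n) (Leaf n false).

(* There are countably many decision trees, so every set of trees is taken to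
   be measurable and [probability (dtree n) R] is the type of all probability
   distributions over deterministic decision trees. *)
HB.instance Definition _ (n : nat) :=
  @isMeasurable.Build default_measure_display (dtree n)
    (@discrete_measurable (dtree n)) (@discrete_measurable0 (dtree n))
    (@discrete_measurableC (dtree n)) (@discrete_measurableU (dtree n)).

Definition zero_error (R : realType) (n : nat) (h : letter_fun n)
    (mu : probability (dtree n) R) : Prop :=
  forall x b, h x = Some b -> mu [set t | output t x = b] = 1.

Definition expected_queries (R : realType) (n : nat)
    (mu : probability (dtree n) R) (x : {ffun 'I_n -> letter}) : \bar R :=
  \int[mu]_t ((queries t x)%:R)%:E.

(* The default value 0 only matters when the domain of [h] is empty. *)
Definition worst_queries (R : realType) (n : nat) (h : letter_fun n)
    (mu : probability (dtree n) R) : \bar R :=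
  \big[maxe/0]_(x | h x != None) expected_queries mu x.

(* The minimum over zero-error randomized algorithms, written as an infimum:
   removing repeated queries leaves finitely many trees, so it is attained.
   If the domain of [h] is empty, every algorithm is zero-error and has worst
   case 0, so that the value is 0. *)
Definition R0 (R : realType) (n : nat) (h : letter_fun n) : \bar R :=
  ereal_inf [set worst_queries h mu | mu in @zero_error R n h].

(* [sabotaged f Star] is P_f and [sabotaged f Dagger] is P_f^dagger. *)
Definition sabotaged (n : nat) (f : bool_fun n) (c : letter)
    (p : {ffun 'I_n -> letter}) : bool :=
  [exists x : {ffun 'I_n -> bool}, exists y : {ffun 'I_n -> bool},
    [&& f x != None, f y != None, f x != f y &
      [forall i, (p i != c) ==> (p i == Bit (x i)) && (p i == Bit (y i))]]].

(* The two cases are disjoint: a string in both would be a bit string equal to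
   two inputs on which [f] differs. *)
Definition f_sab (n : nat) (f : bool_fun n) : letter_fun n := fun p =>
  if sabotaged f Star p then Some false
  else if sabotaged f Dagger p then Some true
  else None.

Definition not_bit (a : letter) : bool :=
  match a with Bit _ => false | _ => true end.

Definition f_usab (n : nat) (f : bool_fun n) : letter_fun n := fun p =>
  if #|[pred i | not_bit (p i)]| == 1%N then f_sab f p else None.

Definition RS (R : realType) (n : nat) (f : bool_fun n) : \bar R :=
  R0 R (f_sab f).

Definition RSu (R : realType) (n : nat) (f : bool_fun n) : \bar R :=
  R0 R (f_usab f).

(* Main.v *)
Require Import Defs.
From HB Require Import structures.
From mathcomp Require Import all_boot all_order all_algebra.
From mathcomp Require Import all_classical all_reals all_analysis.

Set Implicit Arguments.
Unset Strict Implicit.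
Unset Printing Implicit Defensive.

Import Order.TTheory GRing.Theory Num.Theory.

(* Run a zero-error algorithm for unique sabotage but stop at the first letter
   that is not a bit, answering according to that letter.  Let p be sabotaged,
   with completions x, y such that f x <> f y.  Since f is total, some two
   consecutive hybrids of x and y differ in f, and they differ in one position
   i with p i not a bit; writing Star, resp. Dagger, at i gives two uniquely
   sabotaged inputs with opposite answers that agree with p wherever p is a
   bit.  A tree correct on both must query i, so on p it meets a non-bit, and
   it does so within the number of queries it makes on either of the two. *)

Local Open Scope classical_set_scope.
Local Open Scope ring_scope.
Local Open Scope ereal_scope.

(** The complement of [C] lies in the union of two null sets, the complements of [A] and [B]. *)
Lemma probability1_subI d (T : measurableType d) (R : realType)
    (P : probability T R) (A B C : set T) :
  measurable A -> measurable B -> measurable C -> A `&` B `<=` C ->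
  P A = 1 -> P B = 1 -> P C = 1.
Proof.
move=> mA mB mC ABC PA PB.
have PC : P (~` C) <= 0.
  have mAB : measurable (~` A `|` ~` B).
    by apply: measurableU; apply: measurableC.
  apply: (@le_trans _ _ (P (~` A `|` ~` B))).
    apply: le_measure; rewrite ?inE //; first exact: measurableC.
    by rewrite -setCI; apply: subsetC.
  have PAB : P (~` A `|` ~` B) <= P (~` A) + P (~` B).
    by apply: measureU2; apply: measurableC.
  apply: (le_trans PAB); rewrite (probability_setC P mA) (probability_setC P mB) PA PB.
  by rewrite subee // adde0.
rewrite -[C]setCK (probability_setC P (measurableC mC)).
have -> : P (~` C) = 0 by apply/eqP; rewrite eq_le PC /=.
by rewrite sube0.
Qed.

(** Deliberately asymmetric: [q] is unconstrained wherever [p] is not a bit. *)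
Definition agree_on_bits n (p q : {ffun 'I_n -> letter}) : Prop :=
  forall i, ~~ not_bit (p i) -> q i = p i.

Fixpoint halt n (t : dtree n) : dtree n :=
  match t with
  | Leaf b => Leaf n b
  | Query i k =>
      Query i (fun a => if not_bit a then Leaf n (a == Dagger) else halt (k a))
  end.

(** While only bits of [p] are read, [t] follows the same path on [q]; the query that meets the
    first non-bit is counted on both sides. *)
Lemma queries_halt n (t : dtree n) (p q : {ffun 'I_n -> letter}) :
  agree_on_bits p q -> (queries (halt t) p <= queries t q)%N.
Proof.
move=> pq; elim: t => [//|i k IH] /=; rewrite ltnS.
by case: ifPn => // bit_pi; rewrite pq.
Qed.

(** The bits of [p] lead [q] and [r] along one path. Reaching a leaf on it would give them equal
    outputs, so a non-bit is met first, and it is [c]. *)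
Lemma output_halt n (t : dtree n) (c : letter) (p q r : {ffun 'I_n -> letter}) :
  (forall i, not_bit (p i) -> p i = c) ->
  agree_on_bits p q -> agree_on_bits p r -> output t q != output t r ->
  output (halt t) p = (c == Dagger).
Proof.
move=> pc pq pr; elim: t => [b|i k IH] /=; first by rewrite eqxx.
case: ifPn => [bad_pi _|bit_pi]; first by rewrite /= (pc _ bad_pi).
by rewrite pq // pr //; exact: IH.
Qed.

Definition hybrid n (x y : {ffun 'I_n -> bool}) (k : nat) :
  {ffun 'I_n -> bool} := [ffun i : 'I_n => if (i < k)%N then y i else x i].

(** The hybrids go from [x] at 0 to [y] at [n]; were no step to change [f], it would be constant
    along the way. *)
Lemma hybrid_edge n (f : {ffun 'I_n -> bool} -> bool)
    (x y : {ffun 'I_n -> bool}) : f x != f y ->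
  exists k : 'I_n, f (hybrid x y k) != f (hybrid x y k.+1).
Proof.
move=> fxy; apply/existsP; apply: contraNT fxy; rewrite negb_exists => /forallP h.
have hk k : (k <= n)%N -> f (hybrid x y k) = f x.
  elim: k => [_|k IH lt_kn].
    by congr f; apply/ffunP => i; rewrite ffunE.
  rewrite -IH; last exact: ltnW.
  by have /negPn/eqP := h (Ordinal lt_kn).
rewrite -(hk n) //; apply/eqP; congr f; apply/ffunP => i.
by rewrite ffunE ltn_ord.
Qed.

Definition punch n (x : {ffun 'I_n -> bool}) (k : 'I_n) (c : letter) :
  {ffun 'I_n -> letter} := [ffun i => if i == k then c else Bit (x i)].

Lemma card_not_bit_punch n (x : {ffun 'I_n -> bool}) k c : not_bit c ->
  #|[pred i | not_bit (punch x k c i)]| = 1%N.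
Proof.
move=> bad_c; rewrite -(card1 k); apply: eq_card => i.
by rewrite !inE ffunE; case: eqP.
Qed.

Lemma f_sab_star n (f : bool_fun n) p :
  sabotaged f Star p -> f_sab f p = Some false.
Proof. by rewrite /f_sab => ->. Qed.

(** [f_sab] tests [Star] first; a [Dagger] in [p] makes that test fail. *)
Lemma f_sab_dagger n (f : bool_fun n) (p : {ffun 'I_n -> letter}) i :
  p i = Dagger -> sabotaged f Dagger p -> f_sab f p = Some true.
Proof.
rewrite /f_sab => pi ->; case: ifP => // /existsP[x /existsP[y /and4P[_ _ _]]].
by move=> /forallP/(_ i); rewrite pi.
Qed.

Lemma f_usab_punch n (f : {ffun 'I_n -> bool} -> bool)
    (x y : {ffun 'I_n -> bool}) k c : not_bit c -> f x != f y ->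
  (forall i, i != k -> x i = y i) ->
  f_usab (fun x => Some (f x)) (punch x k c) = Some (c == Dagger).
Proof.
move=> bad_c fxy xy; rewrite /f_usab card_not_bit_punch // eqxx.
have : sabotaged (fun x => Some (f x)) c (punch x k c).
  apply/existsP; exists x; apply/existsP; exists y.
  rewrite /= (inj_eq Some_inj) fxy /=; apply/forallP => i; rewrite ffunE.
  by case: ifPn => [|ik]; rewrite ?eqxx //= -xy // eqxx implybT.
case: c bad_c => // _; first exact: f_sab_star.
by apply: (f_sab_dagger (i := k)); rewrite ffunE eqxx.
Qed.

Lemma f_sab_sabotaged n (f : bool_fun n) p b : f_sab f p = Some b ->
  sabotaged f (if b then Dagger else Star) p.
Proof. by rewrite /f_sab; do 2?case: ifP => // ?; case=> <-. Qed.

Lemma sabotaged_not_bit n (f : bool_fun n) c (p : {ffun 'I_n -> letter}) i :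
  sabotaged f c p -> not_bit (p i) -> p i = c.
Proof.
move=> /existsP[x /existsP[y /and4P[_ _ _ /forallP/(_ i)]]] + bad_pi.
by apply: contraTeq => ->; apply: contraTN bad_pi => /andP[/eqP->].
Qed.

(** Whichever symbol [p] carries, inputs with both answers are needed: the conflict between them
    forces a tree to query a non-bit of [p]. Totality of [f] gives values to the hybrids. *)
Lemma sabotaged_usab n (f : {ffun 'I_n -> bool} -> bool) c p :
  not_bit c -> sabotaged (fun x => Some (f x)) c p ->
  exists q : bool -> {ffun 'I_n -> letter}, forall b,
    agree_on_bits p (q b) /\ f_usab (fun x => Some (f x)) (q b) = Some b.
Proof.
move=> bad_c /existsP[x /existsP[y /and4P[_ _]]].
rewrite (inj_eq Some_inj) => /hybrid_edge[k fk] /forallP pxy.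
exists (fun b => punch (hybrid x y k) k (if b then Dagger else Star)) => b.
have pbit i : ~~ not_bit (p i) -> p i = Bit (x i) /\ p i = Bit (y i).
  move=> bit_pi; have /implyP/(_ _)/andP[|/eqP px /eqP py] := pxy i => //.
  by apply: contraNneq bit_pi => ->.
split.
  move=> i /pbit[px py]; have xyi : x i = y i by move: px; rewrite py => -[].
  rewrite !ffunE; case: eqP => [ik|_]; last by rewrite px xyi if_same.
  (* A bit of [p] at position [k] would make [x] and [y] equal there, hence the two hybrids equal,
     against [fk]. *)
  case/eqP: fk; congr f; apply/ffunP => j; rewrite !ffunE ltnS [in RHS]leq_eqVlt.
  have [->|jk] := eqVneq j k; first by rewrite -ik xyi !if_same.
  by rewrite (negPf (jk : nat_of_ord j != k)).
rewrite (f_usab_punch _ fk) //; [by case: b | by case: b |].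
move=> i ik; rewrite !ffunE ltnS [in RHS]leq_eqVlt.
by rewrite (negPf (_ : nat_of_ord i != k)).
Qed.

Lemma measurable_dtree n d (T : measurableType d) (g : dtree n -> T) :
  measurable_fun setT g.
Proof. by []. Qed.

HB.instance Definition _ n :=
  @isMeasurableFun.Build _ _ (dtree n) (dtree n) (@halt n)
    (measurable_dtree (@halt n)).

Lemma R0_le (R : realType) n (g h : letter_fun n) :
  (forall mu : probability (dtree n) R, zero_error h mu ->
    exists2 nu : probability (dtree n) R, zero_error g nu &
      worst_queries g nu <= worst_queries h mu) ->
  R0 R g <= R0 R h.
Proof.
move=> gh; apply: le_ereal_inf_tmp => _ [mu /gh[nu zg le_gh] <-].
by apply: le_trans le_gh; apply: ereal_inf_lbound; exists nu.
Qed.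

Lemma worst_queries_le (R : realType) n (g h : letter_fun n)
    (nu mu : probability (dtree n) R) :
  (forall p, g p != None -> exists2 q, h q != None &
    expected_queries nu p <= expected_queries mu q) ->
  worst_queries g nu <= worst_queries h mu.
Proof.
move=> gh; apply/bigmax_leP; split; first exact: bigmax_ge_id.
by move=> p /gh[q hq /le_trans]; apply; apply: le_bigmax_cond.
Qed.

(** Change of variables along [halt] reduces this to the treewise bound. *)
Lemma expected_queries_halt (R : realType) n (mu : probability (dtree n) R)
    (p q : {ffun 'I_n -> letter}) : agree_on_bits p q ->
  expected_queries (distribution mu (@halt n)) p <= expected_queries mu q.
Proof.
move=> pq; rewrite /expected_queries ge0_integral_distribution //.
apply: ge0_le_integral => // t _ /=; first by rewrite lee_fin.
by rewrite lee_fin ler_nat queries_halt.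
Qed.

Lemma zero_error_halt (R : realType) n (f : {ffun 'I_n -> bool} -> bool)
    (mu : probability (dtree n) R) :
  zero_error (f_usab (fun x => Some (f x))) mu ->
  zero_error (f_sab (fun x => Some (f x))) (distribution mu (@halt n)).
Proof.
move=> mu0 p b /f_sab_sabotaged sab.
have [|q q_ok] := sabotaged_usab _ sab; first by case: b {sab}.
have [pq0 q0] := q_ok false; have [pq1 q1] := q_ok true.
apply: (probability1_subI _ _ _ _ (mu0 _ _ q0) (mu0 _ _ q1)) => // t [/= t0 t1].
rewrite (output_halt (fun i => sabotaged_not_bit sab) pq0 pq1) ?t0 ?t1 //.
by case: b {sab}.
Qed.

Theorem theorem14 (R : realType) (n : nat) (f : {ffun 'I_n -> bool} -> bool) :
  RSu R (fun x => Some (f x)) = RS R (fun x => Some (f x)).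
Proof.
apply/eqP; rewrite eq_le; apply/andP; split; apply: R0_le => mu mu0.
(* [f_usab] restricts [f_sab], so the same algorithm serves. *)
- have sub p b : f_usab (fun x => Some (f x)) p = Some b ->
      f_sab (fun x => Some (f x)) p = Some b by rewrite /f_usab; case: ifP.
  exists mu; first by move=> p b /sub; exact: mu0.
  apply: worst_queries_le => p; case E: f_usab => [b|//] _.
  by exists p => //; rewrite (sub _ _ E).
- exists (distribution mu (@halt n)); first exact: zero_error_halt.
  apply: worst_queries_le => p; case E: f_sab => [b|//] _.
  have [|q /(_ b)[pq qb]] := sabotaged_usab _ (f_sab_sabotaged E).
    by case: b {E}.
  (* Either answer would do for the cost; [b] is simply at hand. *)
  by exists (q b); [rewrite qb | exact: expected_queries_halt].
Qed.
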